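(* Let $q=p^n$, where $p$ is a prime and $n$ is a positive integer, and let $\mathbf{F}_q$ be the finite field with $q$ elements. Let $f(t)=a_0+a_1t+\dots+a_{d-1}t^{d-1}+t^d\in\mathbf{F}_q[t]$ be a monic polynomial of degree $d\ge 1$ with $a_0\neq 0$, let $[f]$ be its companion matrix, and let $m=\operatorname{ord} f(t)$ be the multiplicative order of $[f]$. Then: 1) $m\le q^d-1$, and $m=q^d-1$ if and only if $f(t)$ is a primitive irreducible polynomial over $\mathbf{F}_q$; 2) $f(t)$ is irreducible over $\mathbf{F}_q$ if and only if all of the following hold: $p$ does not divide $m$; $d$ equals the multiplicative order of $q \pmod m$; and $\operatorname{rk}([f]^l-E)=d$ for every positive integer $l<m$ that divides $m$.
   Context: The companion matrix of the monic polynomial $f(t)=a_0+a_1t+\dots+a_{d-1}t^{d-1}+t^d$ is the $d\times d$ matrix $[f]$ whose $i$-th row, for $1\le i\le d-1$, has a $1$ in column $i+1$ and zeros elsewhere, and whose last row is $(-a_0,-a_1,\dots,-a_{d-1})$. The multiplicative order of an invertible square matrix $A$ over $\mathbf{F}_q$ is the least positive integer $l$ with $A^l=E$, where $E$ is the identity matrix; the order of $f$ (with $a_0\ne0$) is defined as the multiplicative order of $[f]$. For a positive integer $m$ not divisible by $p$, the multiplicative order of $q \pmod m$ is the least positive integer $e$ such that $m$ divides $q^e-1$. A polynomial of degree $d$ over $\mathbf{F}_q$ is primitive irreducible if it is irreducible and its roots generate the multiplicative group of the field $\mathbf{F}_{q^d}$ (equivalently, it is irreducible of order $q^d-1$). 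*)

(* Defs.v *)
From HB Require Import structures.
From mathcomp Require Import all_boot all_order all_fingroup all_algebra.
From mathcomp Require Import all_solvable all_field.

Set Implicit Arguments.
Unset Strict Implicit.
Unset Printing Implicit Defensive.

Import GRing.Theory.
Local Open Scope ring_scope.

Fact mx_order_exists (F : finFieldType) (n : nat) (A : 'M[F]_n) :
  exists l : nat, (0 < l)%N && ((A \in unitmx) ==> (A ^+ l == 1%:M)).
Proof.
case: n A => [|n] A.
  by exists 1%N; apply/implyP=> _; apply/eqP/matrixP=> -[].
have [uA | //] := boolP (A \in unitmx); last by exists 1%N.
pose u : {'GL_n.+1[F]} := FinRing.unit _ uA.
exists #[u]%g; rewrite order_gt0 /=; apply/eqP.
by rewrite -[A]/(val u) -FinRing.val_unitX expg_order.
Qed.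

(* Equal to 1 by convention when A is not invertible. *)
Definition mx_order (F : finFieldType) (n : nat) (A : 'M[F]_n) : nat :=
  ex_minn (mx_order_exists A).

(* companionmx f has size (size f).-1, the degree of f; its last row carries the
   opposites of the coefficients of f, and its other rows the shift. *)
Definition poly_order (F : finFieldType) (f : {poly F}) : nat :=
  mx_order (companionmx f).

Fact mod_order_exists (q m : nat) :
  exists e : nat, (0 < e)%N && (coprime q m ==> (m %| q ^ e - 1)%N).
Proof.
case: (posnP m) => [-> | m_gt0].
  by exists 1%N; rewrite /coprime gcdn0; apply/implyP=> /eqP->.
exists (totient m); rewrite totient_gt0 m_gt0 /=; apply/implyP=> co_qm.
case: (posnP q) => [q0 | q_gt0].
  by move: co_qm; rewrite q0 /coprime gcd0n => /eqP->; rewrite dvd1n.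
by rewrite -eqn_mod_dvd ?expn_gt0 ?q_gt0 //; apply/eqP/Euler_exp_totient.
Qed.

(* Equal to 1 by convention when q and m are not coprime. *)
Definition mod_order (q m : nat) : nat := ex_minn (mod_order_exists q m).

(* A field L with #|F| ^ deg f elements, together with a morphism iota : F -> L,
   is a model of the extension of F of degree deg f.  Such a model exists and is
   unique up to isomorphism, so quantifying over all of them loses nothing; an
   irreducible f has deg f roots in it.  Asking each root to be a unit matters
   only for f = 'X. *)
Definition primitive_irreducible (F : finFieldType) (f : {poly F}) : Prop :=
  irreducible_poly f /\
  forall (L : finFieldType) (iota : {rmorphism F -> L}) (x : L),
    #|L| = (#|F| ^ (size f).-1)%N -> root (map_poly iota f) x ->
    exists2 u : {unit L}, val u = x & generator [set: {unit L}] u.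

(* Main.v *)
(* The minimal polynomial of the companion matrix C of f is f itself, so C^l = 1
   iff f divides X^l - 1, and C^l - 1 is invertible iff f is coprime to X^l - 1.
   Hence ord f is the order of the class of X in the unit group of F[X]/(f),
   which has at most q^d - 1 elements, with equality iff F[X]/(f) is a field.
   If f is irreducible, a root x of f in F[X]/(f) has order m; when m divides
   q^e - 1, the e-th power of the q-Frobenius fixes x, hence the whole field of
   q^d elements, so d <= e.  Conversely, an irreducible factor g of f has order
   dividing m, and the rank condition forces it to be m; then m divides
   q^(deg g) - 1, so d <= deg g and g = f. *)
Require Import Defs.
From mathcomp Require Import all_boot all_order all_fingroup all_algebra.
From mathcomp Require Import all_solvable all_field.

Set Implicit Arguments.
Unset Strict Implicit.
Unset Printing Implicit Defensive.

Import GRing.Theory.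
Local Open Scope ring_scope.

(** * Minimal polynomials and ranks for companion matrices *)

(** Write f = h d and g = k d with d their gcd. Then h g = k f kills [A], and cancelling an
    invertible g(A) gives h(A) = 0, so f divides h and d is constant. The converse evaluates a
    Bezout relation at [A]. *)
Lemma row_free_horner_mx (K : fieldType) n (A : 'M[K]_n.+1) (g : {poly K}) :
  row_free (horner_mx A g) = coprimep (mxminpoly A) g.
Proof.
set f := mxminpoly A; have f0 : f != 0 by rewrite monic_neq0 ?mxminpoly_monic.
apply/idP/idP => [freeg | /Bezout_eq1_coprimepP[[u v] /= uv1]].
  have /dvdpP[h fE] := dvdp_gcdl f g; have /dvdpP[k gE] := dvdp_gcdr f g.
  have f_dvd_h : f %| h.
    rewrite dvd_mxminpoly -(inj_eq (row_free_inj freeg)) mul0mx mulmxE -rmorphM.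
    by rewrite gE mulrCA -fE rmorphM /= mx_root_minpoly mulr0.
  have d0 : gcdp f g != 0 by rewrite gcdp_eq0 (negPf f0).
  have h0 : h != 0 by apply: contraNneq f0 => h0; rewrite fE h0 mul0r.
  have := dvdp_leq h0 f_dvd_h; have := size_mul h0 d0; rewrite -fE => ->.
  rewrite -subn1 leq_subLR addnC leq_add2r coprimep_def => sd.
  by rewrite eqn_leq sd size_poly_gt0.
rewrite row_free_unit; move/(congr1 (horner_mx A)): uv1.
rewrite rmorphD !rmorphM rmorph1 /= mx_root_minpoly mulr0 add0r.
by move/mulmx1_unit=> [].
Qed.

(** The first basis row e_0 is cyclic: the rows e_0 A^i with i <= n are the whole standard basis, so
    no nonzero polynomial of degree at most n kills [A]. *)
Lemma mxminpoly_companion (K : fieldType) n (f : {poly K}) (A : 'M[K]_n.+1) :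
    f \is monic -> size f = n.+2 -> char_poly A = f ->
    (forall (i : 'I_n.+1) (lt_i : (i.+1 < n.+1)%N),
       delta_mx 0 i *m A = delta_mx 0 (Ordinal lt_i) :> 'rV__) ->
  mxminpoly A = f.
Proof.
move=> f_monic sf chA shiftA; set p := mxminpoly A.
have p_monic : p \is monic := mxminpoly_monic A.
have p_dvd : p %| f by rewrite -chA mxminpoly_dvd_char.
apply/eqP; rewrite -eqp_monic // -dvdp_size_eqp //.
rewrite eqn_leq dvdp_leq ?monic_neq0 //= sf ltnNge; apply/negP => sp.
have eA (i : nat) (lti : (i < n.+1)%N) :
    delta_mx 0 0 *m A ^+ i = delta_mx 0 (Ordinal lti) :> 'rV[K]_n.+1.
  elim: i lti => [|i IHi] lti.
    by rewrite expr0 mulmx1; congr delta_mx; apply: val_inj.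
  rewrite exprSr mulmxA (IHi (ltnW lti)) shiftA.
  by congr delta_mx; apply: val_inj.
(* If p has degree at most n, then e_0 p(A) is its coefficient row [v]; it vanishes because p(A) =
   0. *)
have /eqP[] := monic_neq0 p_monic; rewrite -(poly_rV_K sp); apply/eqP.
set v := poly_rV p; have -> : v = delta_mx 0 0 *m horner_mx A p.
  rewrite -(poly_rV_K sp) horner_rVpoly -/v [v *m _]mulmx_sum_row.
  rewrite linear_sum mulmx_sumr.
  rewrite [LHS]row_sum_delta; apply: eq_bigr => i _.
  rewrite linearZ /= rowK mxvecK -scalemxAr eA; congr (_ *: delta_mx _ _).
  exact: val_inj.
by rewrite mx_root_minpoly mulmx0 linear0.
Qed.

(* horner_mx and mxminpoly need a size of the form n.+1, and (size f).-1 is not. *)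
Lemma companionmx_minpoly_ind (K : fieldType) (f : {poly K})
    (P : forall n, 'M[K]_n -> Prop) :
    f \is monic -> (1 < size f)%N ->
    (forall n (A : 'M[K]_n.+1), size f = n.+2 -> mxminpoly A = f -> P n.+1 A) ->
  P _ (companionmx f).
Proof.
move=> f_monic sf IH.
have := companionmxK f_monic; have := @mulmx_delta_companion K f.
have: size f = (size f).-1.+1 by rewrite (ltn_predK sf).
move: (companionmx f); case: (size f).-1 => [|n] A sfn shiftA chA.
  by rewrite sfn in sf.
exact: IH (mxminpoly_companion f_monic sfn chA shiftA).
Qed.

Section CompanionMatrix.

Variables (K : fieldType) (f : {poly K}).
Hypotheses (f_monic : f \is monic) (f_gt1 : (1 < size f)%N).

Lemma companionmx_expr_eq1 l : (companionmx f ^+ l == 1%:M) = (f %| 'X^l - 1).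
Proof.
pose P n (A : 'M[K]_n) : Prop := (A ^+ l == 1%:M) = (f %| 'X^l - 1).
apply: (@companionmx_minpoly_ind K f P) => // n A _ minA; rewrite /P.
rewrite -minA dvd_mxminpoly rmorphB rmorphXn /=.
by rewrite (rmorph1 (horner_mx A)) horner_mx_X subr_eq0.
Qed.

Lemma companionmx_unit : (companionmx f \in unitmx) = coprimep f 'X.
Proof.
pose P n (A : 'M[K]_n) : Prop := (A \in unitmx) = coprimep f 'X.
apply: (@companionmx_minpoly_ind K f P) => // n A _ minA; rewrite /P.
by rewrite -row_free_unit -minA -row_free_horner_mx horner_mx_X.
Qed.

Lemma rank_companionmx_exprB1 l :
  (\rank (companionmx f ^+ l - 1%:M) == (size f).-1) = coprimep f ('X^l - 1).
Proof.
pose P n (A : 'M[K]_n) : Prop :=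
  (\rank (A ^+ l - 1%:M) == n) = coprimep f ('X^l - 1).
apply: (@companionmx_minpoly_ind K f P) => // n A _ minA; rewrite /P.
rewrite -minA -row_free_horner_mx /row_free.
by rewrite rmorphB rmorphXn /= (rmorph1 (horner_mx A)) horner_mx_X.
Qed.

End CompanionMatrix.

(** * The order of a polynomial as the order of a unit of F[X]/(f) *)

Section PolyOrder.

Variables (F : finFieldType) (f : {poly F}).
Hypotheses (f_monic : f \is monic) (f_gt1 : (1 < size f)%N).
Hypothesis f0_neq0 : f`_0 != 0.

Lemma coprimep_polyX : coprimep f 'X.
Proof. by rewrite -['X]subr0 -polyC0 coprimep_XsubC /root horner_coef0. Qed.

Lemma poly_orderP :
  [/\ (0 < poly_order f)%N, f %| 'X^(poly_order f) - 1
    & forall l, (0 < l)%N -> f %| 'X^l - 1 -> (poly_order f <= l)%N].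
Proof.
rewrite /poly_order /mx_order; case: ex_minnP => m.
rewrite companionmx_unit // coprimep_polyX /= => /andP[m_gt0].
rewrite companionmx_expr_eq1 // => f_dvd min_m; split=> // l l_gt0 fl.
by apply: min_m; rewrite l_gt0 companionmx_expr_eq1.
Qed.

Lemma mk_monic_id : mk_monic f = f.
Proof. by rewrite /mk_monic f_gt1 f_monic. Qed.

Lemma in_qpoly_eq0 g : (in_qpoly f g == 0) = (f %| g).
Proof. by rewrite -val_eqE /= mk_monic_id Pdiv.Idomain.dvdpE. Qed.

Lemma in_qpoly_unit g : (in_qpoly f g \is a GRing.unit) = coprimep f g.
Proof.
rewrite -[LHS]/(coprimep (mk_monic f) (Pdiv.CommonRing.rmodp g (mk_monic f))).
by rewrite mk_monic_id -Pdiv.IdomainMonic.modpE // coprimep_modr.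
Qed.

(** Turns [poly_order] into the order of a group element, which gives access to divisibility and
    cardinality facts about finite groups. *)
Lemma poly_order_qpolyX :
  exists2 u : {unit {poly %/ f}}, val u = in_qpoly f 'X & #[u]%g = poly_order f.
Proof.
have uX : in_qpoly f 'X \is a GRing.unit by rewrite in_qpoly_unit coprimep_polyX.
pose u : {unit {poly %/ f}} := FinRing.unit _ uX; exists u => //.
have dvd_u l : (f %| 'X^l - 1) = (#[u]%g %| l)%N.
  rewrite order_dvdn -val_eqE /= FinRing.val_unitX /= -in_qpoly_eq0.
  by rewrite rmorphB rmorphXn rmorph1 subr_eq0.
have [m_gt0 m_dvd m_min] := poly_orderP; apply/eqP.
by rewrite eqn_leq m_min ?order_gt0 ?dvd_u // andbT dvdn_leq // -dvd_u.
Qed.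

Lemma dvdp_Xn_sub1 l : (f %| 'X^l - 1) = (poly_order f %| l)%N.
Proof.
have [u uX <-] := poly_order_qpolyX.
rewrite order_dvdn -val_eqE /= FinRing.val_unitX /= uX -in_qpoly_eq0.
by rewrite rmorphB rmorphXn rmorph1 subr_eq0.
Qed.

Lemma poly_order_leq_units :
  (poly_order f <= #|[pred x : {poly %/ f} | x \is a GRing.unit]|)%N.
Proof.
have [u _ <-] := poly_order_qpolyX.
by apply: leq_trans (max_card _) _; rewrite card_sub.
Qed.

Lemma card_qpoly_nonzero :
  #|predC1 (0 : {poly %/ f})| = (#|F| ^ (size f).-1 - 1)%N.
Proof. by rewrite cardC1 card_monic_qpoly // subn1. Qed.

Lemma qpoly_unit_neq0 :
  [pred x : {poly %/ f} | x \is a GRing.unit] \subset predC1 (0 : {poly %/ f}).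
Proof.
by apply/subsetP=> x; rewrite !inE; apply: contraTneq => ->; rewrite unitr0.
Qed.

Lemma poly_order_leq : (poly_order f <= #|F| ^ (size f).-1 - 1)%N.
Proof.
rewrite -card_qpoly_nonzero.
exact: leq_trans poly_order_leq_units (subset_leq_card qpoly_unit_neq0).
Qed.

Lemma poly_order_max_irreducible :
  poly_order f = (#|F| ^ (size f).-1 - 1)%N -> irreducible_poly f.
Proof.
move=> m_max; split=> // g g_neq1 g_dvd; rewrite -dvdp_size_eqp //.
have f0 : f != 0 by rewrite monic_neq0.
rewrite eqn_leq dvdp_leq //= leqNgt; apply: contra g_neq1 => g_lt.
(* Equality holds throughout m <= number of units <= number of nonzero classes, so every nonzero
   class is a unit. The class of a proper nonconstant divisor of f would contradict this. *)
have units_all : [pred x : {poly %/ f} | x \is a GRing.unit]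
                   =i predC1 (0 : {poly %/ f}).
  apply/subset_cardP; last exact: qpoly_unit_neq0.
  apply/eqP; rewrite eqn_leq subset_leq_card ?qpoly_unit_neq0 //=.
  by rewrite card_qpoly_nonzero -m_max poly_order_leq_units.
have := units_all (in_qpoly f g); rewrite !inE in_qpoly_unit in_qpoly_eq0.
have -> : (f %| g) = false.
  apply/negP=> /dvdp_leq; rewrite leqNgt g_lt => /implyP; rewrite implybF negbK.
  by apply/negP; apply: contraNneq f0 => g0; rewrite -dvd0p -g0.
by rewrite coprimep_sym -coprimepp => /(coprimep_dvdl g_dvd).
Qed.

(** * Roots of an irreducible polynomial in an extension field *)

Section Root.

Variables (L : finFieldType) (iota : {rmorphism F -> L}) (x : L).
Hypotheses (f_irr : irreducible_poly f) (fx0 : root (map_poly iota f) x).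

(** If f does not divide g, the two are coprime; they stay coprime over [L], so they share no root
    there. *)
Lemma irreducible_dvdp_root g : (f %| g) = root (map_poly iota g) x.
Proof.
apply/idP/idP => [/dvdpP[h ->] | gx0].
  by rewrite rmorphM /= rootM fx0 orbT.
apply: contraLR gx0; rewrite -irreducible_poly_coprime //.
by rewrite -(coprimep_map iota) => /coprimep_root/(_ fx0).
Qed.

Lemma poly_order_root :
  exists2 u : {unit L}, val u = x & #[u]%g = poly_order f.
Proof.
have ux : x \is a GRing.unit.
  rewrite unitfE; apply: contraNneq f0_neq0 => x0; move: fx0.
  by rewrite x0 -(rmorph0 iota) /root horner_map fmorph_eq0 horner_coef0.
pose u : {unit L} := FinRing.unit _ ux; exists u => //; apply/eqP.
have dvd_u l : (#[u]%g %| l)%N = (poly_order f %| l)%N.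
  rewrite order_dvdn -val_eqE /= FinRing.val_unitX /= -dvdp_Xn_sub1.
  rewrite irreducible_dvdp_root /root rmorphB rmorph1 /= map_polyXn.
  by rewrite hornerD hornerN hornerXn hornerC subr_eq0.
by rewrite eqn_dvd dvd_u dvdnn -dvd_u dvdnn.
Qed.

End Root.

End PolyOrder.

(** * Root fields, the Frobenius map and the order of q modulo m *)

(** The field is F[X]/(f) with the class of X as root. The last clause, that the root generates the
    field over [F], serves to extend Frobenius invariance from the root to every element. *)
Lemma irreducible_root_field (F : finFieldType) (f : {poly F}) :
    f \is monic -> irreducible_poly f ->
  exists (L : finFieldType) (iota : {rmorphism F -> L}) (x : L),
    [/\ #|L| = (#|F| ^ (size f).-1)%N, root (map_poly iota f) x
      & forall y, exists g, y = (map_poly iota g).[x]].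
Proof.
move=> f_monic f_irr; have f_gt1 := f_irr.1.
pose fI : monic_irreducible_poly f := (f_irr, f_monic).
pose L : finFieldType := {poly %/ f with fI}.
pose iota : {rmorphism F -> L} := qpolyC f.
have evalX g : (map_poly iota g).[in_qpoly f 'X : L] = in_qpoly f g.
  by rewrite -(in_qpoly_comp_horner f g 'X) comp_polyXr.
exists L, iota, (in_qpoly f 'X : L); split=> [||y].
- exact: card_qfpoly.
- by rewrite /root evalX -[0]/(0 : {poly %/ f}) in_qpoly_eq0.
- exists (val (y : {poly %/ f})); rewrite evalX.
  exact/val_inj/esym/in_qpoly_small/size_mk_monic.
Qed.

(** The condition on [N] makes y -> y^N additive, hence a ring endomorphism of [L]; fixing the image
    of [F] and x, it fixes all polynomial expressions in x. *)
Lemma horner_map_fixed (F L : fieldType) (iota : {rmorphism F -> L}) N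
    (x : L) (g : {poly F}) :
    [pchar L].-nat N -> (forall c, c ^+ N = c :> F) -> x ^+ N = x ->
  (map_poly iota g).[x] ^+ N = (map_poly iota g).[x].
Proof.
move=> charN cN xN; elim/poly_ind: g => [|g c IHg].
  by rewrite rmorph0 horner0 -(rmorph0 iota) -rmorphXn cN.
rewrite rmorphD rmorphM /= map_polyX map_polyC !hornerE exprDn_pchar //.
by rewrite exprMn IHg xN -rmorphXn cN.
Qed.

Lemma irreducible_monic_factor (F : finFieldType) (f : {poly F}) :
    (1 < size f)%N ->
  exists g, [/\ g \is monic, irreducible_poly g & g %| f].
Proof.
have [n le_f] := ubnP (size f); elim: n => // n IHn in f le_f *; move=> f_gt1.
have f0 : f != 0 by rewrite -size_poly_gt0 ltnW.
have [/irreducibleP f_irr | ] := boolP (irreducibleb f).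
  have c0 : (lead_coef f)^-1 != 0 by rewrite invr_eq0 lead_coef_eq0.
  have eqpf := eqp_scale f c0; exists ((lead_coef f)^-1 *: f); split.
  - by rewrite monicE lead_coefZ mulVf ?lead_coef_eq0.
  - split=> [|g g_neq1]; first by rewrite size_scale.
    by rewrite (eqp_dvdr _ eqpf) (eqp_rtrans eqpf); apply: f_irr.2.
  - by rewrite (eqp_dvdl _ eqpf).
rewrite /irreducibleb f_gt1 negb_forall => /existsP[g].
rewrite negb_imply -Pdiv.Idomain.dvdpE -ltnNge => /andP[g_dvd g_gt1].
have [|h [h_monic h_irr h_dvd]] := IHn g _ g_gt1.
  (* [irreducibleb] only tests candidates of size at most [(size f).-1], so the factor g is strictly
     smaller than f. *)
  by apply: leq_ltn_trans (size_npoly g) _; rewrite (ltn_predK f_gt1).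
by exists h; rewrite (dvdp_trans h_dvd).
Qed.

Lemma mod_orderP q m : coprime q m ->
  [/\ (0 < mod_order q m)%N, (m %| q ^ mod_order q m - 1)%N
    & forall e, (0 < e)%N -> (m %| q ^ e - 1)%N -> (mod_order q m <= e)%N].
Proof.
move=> co; rewrite /mod_order; case: ex_minnP => e; rewrite co /=.
case/andP=> e_gt0 m_e min_e; split=> // k k_gt0 m_k.
by apply: min_e; rewrite k_gt0.
Qed.

Lemma irreducible_poly_order_dvd (F : finFieldType) (f : {poly F}) :
    f \is monic -> f`_0 != 0 -> irreducible_poly f ->
  (poly_order f %| #|F| ^ (size f).-1 - 1)%N.
Proof.
move=> f_monic f0 f_irr.
have [L [iota [x [cardL fx0 _]]]] := irreducible_root_field f_monic f_irr.
have [u _ <-] := poly_order_root f_monic f_irr.1 f0 f_irr fx0.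
by rewrite -cardL subn1 -card_finField_unit order_dvdG ?inE.
Qed.

Lemma irreducible_mod_order (F : finFieldType) (f : {poly F}) :
    f \is monic -> f`_0 != 0 -> irreducible_poly f ->
  coprime #|F| (poly_order f) -> (size f).-1 = mod_order #|F| (poly_order f).
Proof.
move=> f_monic f0 f_irr co_m; have f_gt1 := f_irr.1.
have [] := mod_orderP co_m; set e := mod_order _ _ => e_gt0 m_e min_e.
apply/eqP; rewrite eqn_leq min_e ?irreducible_poly_order_dvd ?andbT //; last first.
  by rewrite -ltnS (ltn_predK f_gt1).
have [L [iota [x [cardL fx0 genL]]]] := irreducible_root_field f_monic f_irr.
have [u ux u_order] := poly_order_root f_monic f_gt1 f0 f_irr fx0.
have F_gt1 : (1 < #|F|)%N := finNzRing_gt1 F.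
have F_gt0 : (0 < #|F|)%N := ltnW F_gt1.
set N := (#|F| ^ e)%N; have N_gt1 : (1 < N)%N by rewrite -(exp1n e) ltn_exp2r.
have cN (c : F) : c ^+ N = c.
  by rewrite /N; elim: (e) => [|k IHk]; rewrite ?expr1 // expnSr exprM IHk expf_card.
have xN : x ^+ N = x.
  have : (u ^+ (N - 1) == 1)%g by rewrite -order_dvdn u_order.
  rewrite -val_eqE /= FinRing.val_unitX ux => /eqP x1.
  by rewrite -(subnK (ltnW N_gt1)) addn1 exprS x1 mulr1.
(* The additive group of [F] is an elementary abelian p-group, so [#|F|] is a power of p; [iota]
   preserves the characteristic. *)
have charN : [pchar L].-nat N.
  have [p p_pr p_char] := finPcharP F.
  rewrite pnatX (eq_pnat _ (fmorph_pchar iota)) (eq_pnat _ (pcharf_eq p_char)).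
  have := fin_ring_pchar_abelem p_char => /abelem_pgroup.
  by rewrite /pgroup cardsT => ->.
have allN (y : L) : y ^+ N = y.
  by have [g ->] := genL y; apply: horner_map_fixed.
rewrite -(leq_exp2l _ _ F_gt1) -cardL -/N.
(* All elements of [L] are roots of this polynomial of degree N = q^e, so q^d <= q^e. *)
pose P : {poly L} := 'X^N - 'X.
have sP : size P = N.+1.
  by rewrite size_polyDl ?size_polyXn // size_polyN size_polyX ltnS.
have P0 : P != 0 by rewrite -size_poly_eq0 sP.
rewrite cardE -ltnS -sP; apply: max_poly_roots P0 _ (enum_uniq _).
by apply/allP=> y _; rewrite /root !hornerE allN subrr.
Qed.

Theorem theorem1 (p n q : nat) (F : finFieldType) (d m : nat) (f : {poly F})
    (p_pr : prime p) (n_gt0 : (0 < n)%N) (def_q : q = (p ^ n)%N)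
    (card_F : #|F| = q)
    (d_gt0 : (1 <= d)%N) (f_monic : f \is monic) (deg_f : size f = d.+1)
    (a0_neq0 : f`_0 != 0) (def_m : m = poly_order f) :
  ((m <= q ^ d - 1)%N /\
   (m = (q ^ d - 1)%N <-> primitive_irreducible f)) /\
  (irreducible_poly f <->
     [/\ ~~ (p %| m)%N,
         d = mod_order q m
       & forall l : nat, (0 < l)%N -> (l < m)%N -> (l %| m)%N ->
           \rank (companionmx f ^+ l - 1%:M) = d]).
Proof.
have f_gt1 : (1 < size f)%N by rewrite deg_f ltnS.
have d_def : (size f).-1 = d by rewrite deg_f.
have [m_gt0 f_dvd m_min] := poly_orderP f_monic f_gt1 a0_neq0.
have q_gt1 : (1 < q)%N by rewrite -card_F finNzRing_gt1.
have qX_gt0 k : (0 < q ^ k)%N by rewrite expn_gt0 ltnW.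
have co_qm : coprime q m = ~~ (p %| m)%N.
  by rewrite def_q coprime_pexpl // prime_coprime.
rewrite -def_m in m_gt0 f_dvd m_min; split; last split=> [f_irr | [p_m d_ord rank_l]].
- have m_le := poly_order_leq f_monic f_gt1 a0_neq0.
  rewrite -def_m d_def card_F in m_le; split=> //; split=> [m_max | [f_irr prim]].
    have f_irr : irreducible_poly f.
      by apply: poly_order_max_irreducible; rewrite // -def_m d_def card_F.
    split=> // L iota x cardL fx0.
    have [u ux u_order] := poly_order_root f_monic f_gt1 a0_neq0 f_irr fx0.
    (* The cyclic group generated by [u] has m = q^d - 1 elements, as many as the unit group
       containing it. *)
    exists u => //; rewrite /generator eq_sym eqEcard subsetT /= -orderE u_order.
    by rewrite card_finField_unit cardL d_def card_F -subn1 -m_max def_m.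
  (* [prim] speaks of roots in arbitrary models, so one model with an actual root must be
     supplied. *)
  have [L [iota [x [cardL fx0 _]]]] := irreducible_root_field f_monic f_irr.
  have [u ux u_order] := poly_order_root f_monic f_gt1 a0_neq0 f_irr fx0.
  have [v vx v_gen] := prim L iota x cardL fx0.
  have uv : u = v by apply: val_inj; rewrite ux.
  rewrite def_m -u_order uv orderE -(eqP v_gen) card_finField_unit cardL.
  by rewrite d_def card_F subn1.
- have p_m : ~~ (p %| m)%N.
    have m_dvd := irreducible_poly_order_dvd f_monic a0_neq0 f_irr.
    rewrite -def_m d_def card_F in m_dvd; apply/negP=> /dvdn_trans/(_ m_dvd).
    (* Since p divides q^d, dividing q^d - 1 as well would make it divide 1. *)
    rewrite dvdn_subr //; last by rewrite def_q -expnM dvdn_exp // muln_gt0 n_gt0.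
    by rewrite dvdn1 => /eqP p1; rewrite p1 in p_pr.
  split=> // [|l l_gt0 l_lt l_dvd].
    rewrite -d_def -card_F def_m; apply: irreducible_mod_order => //.
    by rewrite card_F -def_m co_qm.
  rewrite -d_def; apply/eqP; rewrite rank_companionmx_exprB1 //.
  rewrite irreducible_poly_coprime //; apply/negP=> /(m_min _ l_gt0).
  by rewrite leqNgt l_lt.
have [g [g_monic g_irr g_dvd]] := irreducible_monic_factor f_gt1.
have g0 : g`_0 != 0.
  have /dvdpP[h f_eq] := g_dvd; apply: contraNneq a0_neq0 => g0.
  by rewrite f_eq -horner_coef0 hornerM !horner_coef0 g0 mulr0.
have [l_gt0 g_l _] := poly_orderP g_monic g_irr.1 g0.
have l_dvd : (poly_order g %| m)%N.
  by rewrite -dvdp_Xn_sub1 ?(dvdp_trans g_dvd) //; apply: g_irr.1.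
have g_order : poly_order g = m.
  apply/eqP; rewrite eqn_leq dvdn_leq //= leqNgt; apply/negP=> l_lt.
  (* For l = ord g < m, full rank makes f coprime to X^l - 1, yet the nonconstant g divides both. *)
  have /eqP := rank_l _ l_gt0 l_lt l_dvd.
  rewrite -d_def rank_companionmx_exprB1 // coprimep_sym.
  move=> /(coprimep_dvdl g_dvd); rewrite coprimep_sym => /(coprimep_dvdl g_l).
  by rewrite coprimepp eqn_leq leqNgt g_irr.1.
have sg : size g = size f.
  apply/eqP; rewrite eqn_leq dvdp_leq ?monic_neq0 //=.
  (* As ord g = m divides q^(deg g) - 1, minimality of d = [mod_order q m] yields d <= deg g. *)
  rewrite deg_f -[leqRHS](ltn_predK g_irr.1) ltnS.
  have co : coprime q m by rewrite co_qm.
  have [_ _ min_d] := mod_orderP co; rewrite d_ord min_d //.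
    by rewrite -ltnS (ltn_predK g_irr.1) g_irr.1.
  by rewrite -g_order -card_F irreducible_poly_order_dvd.
suff <- : g = f by [].
by apply/eqP; rewrite -eqp_monic // -dvdp_size_eqp // sg.
Qed.
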